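(* For every balanced bipartite signed graph $\widehat F$ with underlying graph $F$, and every positive integer $n$, $$\mathrm{ex}(n,F)\ \le\ \widehat{\mathrm{ex}}(n,\widehat F)\ \le\ 2\,\mathrm{ex}(n,F).$$
   Context: All graphs are finite and simple. For a graph $G$, $v(G)$ and $e(G)$ denote its numbers of vertices and edges. A signed graph is a pair $\widehat G=(G,\sigma)$ with $G$ a graph (the underlying graph) and $\sigma:E(G)\to\{+1,-1\}$ (a signing of $G$); it is called bipartite if $G$ is bipartite. Switching at a vertex $v$ reverses the signs of all edges incident with $v$; a switching of a signed graph is any signed graph obtained from it by a sequence of vertex-switchings. The sign of a cycle is the product of its edge signs. A signed graph is balanced if every cycle in it is positive (has sign $+1$), or equivalently, if it can be switched to a signed graph all of whose edges are positive. For a graph $F$, a graph is $F$-free if it contains no subgraph isomorphic to $F$, and $\mathrm{ex}(n,F)=\max\{e(G): v(G)=n \text{ and } G \text{ is } F\text{-free}\}$. For a signed graph $\widehat F$, a signed graph is $\widehat F$-free if it contains no signed subgraph isomorphic to a switching of $\widehat F$ (isomorphisms preserve signs), and $\widehat{\mathrm{ex}}(n,\widehat F)=\max\{e(G): v(G)=n \text{ and some signing of } G \text{ is } \widehat F\text{-free}\}$. *)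

(* Defs.v *)
From HB Require Import structures.
From mathcomp Require Import all_boot all_order all_algebra.

Set Implicit Arguments.
Unset Strict Implicit.
Unset Printing Implicit Defensive.

Import GRing.Theory.

(* A finite simple graph on V is a set of 2-element subsets of V. *)
Record graph (V : finType) := Graph {
  edges :> {set {set V}};
  edges_card2 : [forall e in edges, #|e| == 2]
}.

HB.instance Definition _ (V : finType) := [isSub for @edges V].
HB.instance Definition _ (V : finType) := [Finite of graph V by <:].

Definition adj (V : finType) (G : graph V) : rel V :=
  fun x y => [set x; y] \in edges G.

Definition bipartite (V : finType) (G : graph V) : Prop :=
  exists c : V -> bool, forall x y, adj G x y -> c x != c y.

(* A signing stores the sign of the edge e as a boolean, [true] standing for
   -1.  It is total on {set V}; its values off the edge set are never read. *)
Definition signing (V : finType) := {ffun {set V} -> bool}.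

Record sgraph (V : finType) := SGraph {
  underlying :> graph V;
  sgn : signing V
}.

Definition edge_sign (V : finType) (G : sgraph V) (e : {set V}) : int :=
  ((-1) ^+ sgn G e)%R.

Definition switch (V : finType) (v : V) (s : signing V) : signing V :=
  [ffun e : {set V} => if v \in e then ~~ s e else s e].

(* [connect] is the reflexive-transitive closure, so this says that t is
   obtained from s by a (possibly empty) sequence of vertex-switchings. *)
Definition switching (V : finType) : rel (signing V) :=
  connect (fun s t => [exists v, t == switch v s]).

Definition cycle_sign (V : finType) (G : sgraph V) (c : seq V) : int :=
  (\prod_(x <- c) edge_sign G [set x; next c x])%R.

(* A cycle is given by its vertices in cyclic order, without repetition.  The
   bound on the size is needed because [ucycle] also accepts the empty sequence
   and, since [adj] is symmetric, the two ends of a single edge. *)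
Definition balanced (V : finType) (G : sgraph V) : Prop :=
  forall c : seq V, 2 < size c -> ucycle (adj G) c -> cycle_sign G c = 1%R.

(* A copy of F in G is an injective f : W -> V carrying edges to edges, i.e. an
   isomorphism from F onto the subgraph (f(W), f(E(F))) of G, which need not be
   induced. *)
Definition contains (W V : finType) (F : graph W) (G : graph V) : bool :=
  [exists f : {ffun W -> V},
     injectiveb f && [forall e in edges F, f @: e \in edges G]].

Definition scontains (W V : finType) (F : sgraph W) (G : sgraph V) : bool :=
  [exists f : {ffun W -> V},
     injectiveb f &&
     [forall e in edges F,
        (f @: e \in edges G) && (edge_sign G (f @: e) == edge_sign F e)]].

Definition free (W V : finType) (F : graph W) (G : graph V) : bool :=
  ~~ contains F G.

Definition sfree (W V : finType) (F : sgraph W) (G : sgraph V) : bool :=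
  [forall t : signing W,
     switching (sgn F) t ==> ~~ scontains (SGraph F t) G].

(* In [ex] and [signed_ex] the maximum is 0 when no graph qualifies, which happens
   only if F has no edges and at most n vertices. *)
Definition ex (n : nat) (W : finType) (F : graph W) : nat :=
  \max_(G : graph 'I_n | free F G) #|edges G|.

Definition signed_ex (n : nat) (W : finType) (F : sgraph W) : nat :=
  \max_(G : graph 'I_n | [exists s : signing 'I_n, sfree F (SGraph G s)])
     #|edges G|.

(* Main.v *)
Require Import Defs.
From mathcomp Require Import all_boot all_order all_algebra.

(** Because [F] is balanced, its signing is the coboundary of a potential on the
    vertices, so [F] can be switched to the all-positive signing; because [F] is
    bipartite, switching one colour class then makes it all-negative.  Hence in a
    signed graph that is free of the signed [F], the positive edges and the
    negative edges each form an [F]-free graph, which gives the factor 2. *)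

Set Implicit Arguments.
Unset Strict Implicit.
Unset Printing Implicit Defensive.

Import GRing.Theory.

Lemma nuniq_split (T : eqType) (s : seq T) :
  ~~ uniq s -> exists x s1 s2 s3, s = s1 ++ x :: s2 ++ x :: s3.
Proof.
elim: s => [|x s IHs] //=; rewrite negb_and negbK => /orP[|/IHs].
  by case/splitPr=> s1 s2; exists x, [::], s1, s2.
by case=> y [s1 [s2 [s3 ->]]]; exists y, (x :: s1), s2, s3.
Qed.

(** Lets the sign of a cycle, read through [next], be computed along the walk that starts and ends
    at [x]. *)
Lemma pairmap_next (T : eqType) (R : Type) (f : T -> T -> R) (x : T) (p : seq T) :
  uniq (x :: p) ->
  pairmap f x (rcons p x) = [seq f y (next (x :: p) y) | y <- x :: p].
Proof.
move=> Up; apply: (@eq_from_nth _ (f x x)).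
  by rewrite size_pairmap size_map size_rcons.
move=> i; rewrite size_pairmap size_rcons => lti.
rewrite (nth_pairmap x) ?size_rcons // (nth_map x) //.
rewrite -rcons_cons nth_rcons lti next_nth mem_nth // index_uniq // nth_rcons.
(* Past the end of [p], the default [x] of [nth] is the wrap-around of [next] to the head. *)
case: ltnP => // lepi; rewrite [nth x p i]nth_default //.
by case: eqP.
Qed.

Section Walks.

Variables (V : finType) (G : graph V) (s : signing V).

Lemma edge_set2 (e : {set V}) :
  e \in edges G -> exists x y, x != y /\ e = [set x; y].
Proof.
move=> eG; have /forall_inP/(_ e eG)/cards2P[x [y [nxy ->]]] := edges_card2 G.
by exists x, y; split.
Qed.

Lemma adjxx (x : V) : adj G x x = false.
Proof.
apply: contraTF (edges_card2 G) => Gxx.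
by apply/forall_inPn; exists [set x; x]; rewrite // setUid cards1.
Qed.

Lemma adj_sym : symmetric (adj G).
Proof. by move=> x y; rewrite /adj setUC. Qed.

(** With [true] for -1, products of signs become sums in [bool]. Unlike the cycles of [balanced], a
    walk may repeat vertices. *)
Definition walk_sign (x : V) (p : seq V) : bool :=
  \big[addb/false]_(b <- pairmap (fun y z => s [set y; z]) x p) b.

Lemma walk_sign_nil x : walk_sign x [::] = false.
Proof. by rewrite /walk_sign big_nil. Qed.

Lemma walk_sign_cons x y p :
  walk_sign x (y :: p) = s [set x; y] (+) walk_sign y p.
Proof. by rewrite /walk_sign /= big_cons. Qed.

Lemma walk_sign_cat x p q :
  walk_sign x (p ++ q) = walk_sign x p (+) walk_sign (last x p) q.
Proof. by rewrite /walk_sign pairmap_cat big_cat. Qed.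

Lemma cycle_sign_walk x p : uniq (x :: p) ->
  cycle_sign (SGraph G s) (x :: p) = ((-1) ^+ walk_sign x (rcons p x))%R.
Proof.
move=> Up; rewrite /walk_sign pairmap_next // big_map /cycle_sign.
by apply/esym/(big_morph (fun b : bool => (-1) ^+ b : int)%R); first exact: signr_addb.
Qed.

Hypothesis G_bal : balanced (SGraph G s).

(* A closed walk that revisits a vertex splits into two shorter closed walks;
   one that does not is trivial, a doubled edge, or a cycle. *)
Lemma balanced_closed_walk x p :
  path (adj G) x p -> last x p = x -> walk_sign x p = false.
Proof.
have [m] := ubnP (size p); elim: m x p => // m IHm x p.
(* Repetition is tested on [p] alone, because a nonempty closed walk has [x] again as the last entry
   of [p]. *)
have [Up | /nuniq_split[y [p1 [p2 [p3 ->]]]]] := boolP (uniq p).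
  move=> _; case/lastP: p Up => [|p z]; first by rewrite walk_sign_nil.
  rewrite last_rcons => Up Gp zx; move: Up Gp; rewrite {z}zx rcons_uniq => Up Gp.
  have [p_gt1 | ] := ltnP 1 (size p).
    have := G_bal (c := x :: p) p_gt1; rewrite /ucycle /= Gp Up cycle_sign_walk //.
    by move=> /(_ isT); case: walk_sign.
  case: p Gp {Up} => [|y [|//]] /=; first by rewrite adjxx.
  by rewrite !walk_sign_cons walk_sign_nil setUC addbF addbb.
rewrite size_cat /= size_cat /= => lt_m.
rewrite !(cat_path, last_cat) /= !(cat_path, last_cat) /=.
case/and5P=> Gp1 Gy Gp2 Gy' Gp3 lastx.
(* The outer walk skips the detour between two visits of [y]; the detour [rcons p2 y] is itself
   closed at [y]. *)
have /IHm : size (p1 ++ y :: p3) < m.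
  by rewrite size_cat -ltnS (leq_trans _ lt_m) //= !addnS !ltnS leq_add2l leq_addl.
move/(_ x); rewrite cat_path last_cat /= Gp1 Gy Gp3 => /(_ isT lastx).
have /IHm : size (rcons p2 y) < m.
  rewrite size_rcons -ltnS (leq_trans _ lt_m) // !addnS !ltnS addnCA leq_addr //.
move/(_ y); rewrite rcons_path last_rcons Gp2 Gy' => /(_ isT erefl).
rewrite -cats1 !(walk_sign_cat, walk_sign_cons) walk_sign_nil addbF => sign_in sign_out.
by rewrite [X in _ (+) (_ (+) X)]addbA sign_in.
Qed.

(** Take as potential of [x] the sign of a chosen walk from [x] to the root of its component. *)
Lemma balanced_potential :
  exists c : V -> bool, forall x y, adj G x y -> s [set x; y] = c x (+) c y.
Proof.
have Gsym : connect_sym (adj G) by apply/sym_connect_sym/adj_sym.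
pose r := fingraph.root (adj G).
have walk_from x : exists2 p, path (adj G) (r x) p & last (r x) p = x.
  have: connect (adj G) (r x) x by rewrite Gsym connect_root.
  by case/connectP=> p; exists p.
have walk_to x : exists2 q, path (adj G) x q & last x q = r x.
  by case/connectP: (connect_root (adj G) x) => q; exists q.
have [p Gp lastp] := fin_all_exists2 walk_from.
have [q Gq lastq] := fin_all_exists2 walk_to.
(* Going out along [p x] and back along [q x] is a closed walk, so both have the same sign; no walk
   has to be reversed. *)
have pq x : walk_sign (r x) (p x) = walk_sign x (q x).
  have := @balanced_closed_walk (r x) (p x ++ q x).
  rewrite cat_path last_cat walk_sign_cat !lastp Gp Gq lastq => /(_ isT erefl).
  by case: walk_sign; case: walk_sign.
exists (fun x => walk_sign x (q x)) => x y Gxy.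
have rxy : r x = r y by apply/eqP; rewrite /r root_connect ?connect1.
(* The edge [xy] closes up the walk from the root to [x] and the walk from [y] back to the same
   root. *)
have := @balanced_closed_walk (r x) (p x ++ y :: q y).
rewrite cat_path last_cat walk_sign_cat lastp /= Gp Gxy Gq lastq walk_sign_cons pq.
by move=> /(_ isT (esym rxy)); do 2!case: walk_sign; case: (s _).
Qed.

End Walks.

(** Switch once at each vertex where [c] is true: an edge changes sign once for each such end. *)
Lemma switching_potential (V : finType) (s : signing V) (c : V -> bool) :
  switching s [ffun e : {set V} => s e (+) \big[addb/false]_(v in e) c v].
Proof.
pose t l : signing V := [ffun e => s e (+) \big[addb/false]_(v <- l | v \in e) c v].
(* The sum over all vertices is the case where [l] enumerates [V], which allows induction on [l]. *)
suff st l : switching s (t l) by apply: st.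
elim: l => [|v l IHl].
  suff -> : t [::] = s by apply: connect0.
  by apply/ffunP=> e; rewrite ffunE big_nil addbF.
apply: connect_trans IHl _; have [cv | ncv] := boolP (c v); last first.
  suff -> : t (v :: l) = t l by apply: connect0.
  by apply/ffunP=> e; rewrite !ffunE big_cons (negPf ncv) addFb if_same.
apply/connect1/existsP; exists v; apply/eqP/ffunP=> e.
by rewrite !ffunE big_cons cv; case: ifP => // _; rewrite addTb addbN.
Qed.

Lemma switching_constant (W : finType) (F : sgraph W) (b : bool) :
  bipartite F -> balanced F ->
  exists2 t, switching (sgn F) t & forall e, e \in edges F -> t e = b.
Proof.
case: F => F s /= [col Fcol] /balanced_potential[c Fc].
(* On edges [c] cancels the signing; for [b] true, [col] then flips every edge, as its ends differ
   in colour. *)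
exists [ffun e : {set W} => s e (+) \big[addb/false]_(v in e) (c v (+) (b && col v))].
  exact: switching_potential.
move=> e eF; have [x [y [nxy defe]]] := edge_set2 eF.
move: eF; rewrite ffunE defe big_setU1 ?inE //= big_set1 => Fxy.
rewrite (Fc _ _ Fxy); move: (Fcol _ _ Fxy).
by case: b (c x) (c y) (col x) (col y) => [] [] [] [] [].
Qed.

Lemma sign_class_card2 (V : finType) (G : graph V) (s : signing V) (b : bool) :
  [forall e in [set e in edges G | s e == b], #|e| == 2].
Proof.
apply/forall_inP=> e; rewrite inE => /andP[eG _].
exact: (forall_inP (edges_card2 G)).
Qed.

Definition sign_class (V : finType) (G : graph V) (s : signing V) (b : bool) :=
  Graph (sign_class_card2 G s b).

Lemma card_sign_class (V : finType) (G : graph V) (s : signing V) :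
  #|edges G| = #|edges (sign_class G s true)| + #|edges (sign_class G s false)|.
Proof.
rewrite -(cardsID [set e | s e] (edges G)).
by congr (_ + _); apply: eq_card => e; rewrite !inE; case: (s e); rewrite ?andbT ?andbF.
Qed.

(** A copy of [F] inside one sign class would be a signed copy of the switching of [F] with that
    constant sign. *)
Lemma sfree_sign_class (W V : finType) (F : sgraph W) (G : graph V)
    (s : signing V) (b : bool) :
  bipartite F -> balanced F -> sfree F (SGraph G s) -> Defs.free F (sign_class G s b).
Proof.
move=> F_bip F_bal; have [t Ft tb] := switching_constant b F_bip F_bal.
move/forallP/(_ t)/implyP/(_ Ft); apply: contra => /existsP[f /andP[injf Ff]].
apply/existsP; exists f; rewrite injf; apply/forall_inP=> e eF.
have := forall_inP Ff e eF; rewrite inE => /andP[-> /eqP sfe].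
by rewrite /edge_sign /= sfe tb.
Qed.

(** Forgetting signs turns a signed copy of any switching into a copy of [F]. *)
Lemma free_sfree (W V : finType) (F : sgraph W) (G : sgraph V) :
  Defs.free F G -> sfree F G.
Proof.
move=> freeFG; apply/forallP=> t; apply/implyP=> _; apply: contra freeFG.
case/existsP=> f /andP[injf /forall_inP Ff]; apply/existsP; exists f.
by rewrite injf; apply/forall_inP=> e /Ff /andP[].
Qed.

Theorem mainTheorem1 (W : finType) (F : sgraph W) (n : nat)
  (n_gt0 : 0 < n) (F_bip : bipartite F) (F_bal : balanced F) :
  ex n F <= signed_ex n F <= 2 * ex n F.
Proof.
apply/andP; split; apply/bigmax_leqP => G.
  move=> freeFG; apply: (leq_bigmax_cond (F := fun G : graph 'I_n => #|edges G|)).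
  by apply/existsP; exists [ffun=> false]; apply: free_sfree.
case/existsP=> s sfreeFG; rewrite (card_sign_class G s) mul2n -addnn.
apply: leq_add; apply: (leq_bigmax_cond (F := fun G : graph 'I_n => #|edges G|));
  exact: sfree_sign_class.
Qed.
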